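(* Let $A$, $B$, $C$ be $m \times n$ matrices over $\{-1,0,1\}$ such that $A$ has an entry $0$ and $(A,B,C)$ is independent from $C$. Then ${\rm IST}(A,B,C)=\infty$ if and only if one of the following holds: (1) $A$ and $B$ are layered matrices; or (2) $B$ is the all-$1$ matrix and $A$ has all entries in columns $2,\dots,n$ equal to $1$, with first-column entries $a_1,\dots,a_m\in\{0,1\}$; or (3) $B$ is the all-$1$ matrix and $A$ has all entries in columns $1,\dots,n-1$ equal to $1$, with last-column entries $a_1,\dots,a_m\in\{0,1\}$.
   Context: For an $m\times n$ matrix $M=[m_{ij}]$ over $\{-1,0,1\}$, $G_o(M)$ is the directed graph on $\{1,\dots,n+m\}$ with edges $j\to i$ for all $1\le j<i\le n$, and for $1\le p\le m$, $1\le j\le n$: an edge $j\to n+p$ if $m_{pj}=1$, an edge $n+p\to j$ if $m_{pj}=-1$, no edge if $m_{pj}=0$; no edges among $n+1,\dots,n+m$. A directed graph is semi-transitive if it is acyclic and for every directed path $u_1\to\cdots\to u_t$, $t\ge2$, either there is no edge $u_1\to u_t$ or all edges $u_i\to u_j$ ($1\le i<j\le t$) exist. For $m\times n$ matrices $A,B,C$ over $\{-1,0,1\}$, the morphism $\varphi$ replaces each entry $0,1,-1$ by the block $A,B,C$ respectively; $M^k(A,B,C)=\varphi^k([0])$ and $G_o^k(A,B,C)=G_o(M^k(A,B,C))$. If $A$ has an entry $0$, ${\rm IST}(A,B,C)$ is the least $\ell\ge0$ with $G_o^\ell(A,B,C)$ not semi-transitive, or $\infty$ if none exists. A matrix is layered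 if all entries in each row are identical. The triple $(A,B,C)$ is independent from $C$ if neither $A$ nor $B$ contains an entry $-1$.
   Formalization: The formal theorem additionally assumes that A has an entry 1, i.e. A is not the zero matrix; for A = 0 all M^k(A,B,C) are zero, so IST = ∞ for every B, and the claim fails e.g. for A = [0 0], B = [0 1], C = [0 0]. *)

(* Defs.v *)
From HB Require Import structures.
From mathcomp Require Import all_boot all_order all_algebra.
From mathcomp Require Import boolp mxtens.
Set Implicit Arguments.
Unset Strict Implicit.
Unset Printing Implicit Defensive.
Import Order.TTheory GRing.Theory Num.Theory.
Local Open Scope ring_scope.

(* Rows, columns and vertices are numbered from 0. *)

Definition sign_matrix m n (M : 'M[int]_(m, n)) : Prop :=
  forall p j, M p j \in [:: -1; 0; 1].

(* Vertices of 'I_(n + m): [lshift m j] is the j-th vertex of the transitive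
   tournament (column j), [rshift n p] is the independent vertex of row p. *)
Definition Go m n (M : 'M[int]_(m, n)) : rel 'I_(n + m) :=
  fun u v =>
    match split u, split v with
    | inl j, inl i => (j < i)%N
    | inl j, inr p => M p j == 1
    | inr p, inl j => M p j == -1
    | inr _, inr _ => false
    end.

Definition acyclic (T : eqType) (e : rel T) : Prop :=
  forall c : seq T, cycle e c -> c = [::].

(* The directed path is x :: s, with s nonempty, so it has t >= 2 vertices. *)
Definition semi_transitive (T : eqType) (e : rel T) : Prop :=
  acyclic e /\
  forall (x : T) (s : seq T), s != [::] -> path e x s ->
    ~~ e x (last x s) \/ pairwise e (x :: s).

Section Morphism.
Variables (m n : nat) (A B C : 'M[int]_(m, n)).

(* On entries outside {-1, 0, 1} the value is irrelevant. *)
Definition block (x : int) : 'M[int]_(m, n) :=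
  if x == 0 then A else if x == 1 then B else C.

(* [mxtens_unindex i] is the pair (i %/ m, i %% m): the index of the block and
   the index inside the block. *)
Definition morphism_phi m' n' (M : 'M[int]_(m', n')) :
    'M[int]_(m' * m, n' * n) :=
  \matrix_(i, j) block (M (mxtens_unindex i).1 (mxtens_unindex j).1)
                       (mxtens_unindex i).2 (mxtens_unindex j).2.

Fixpoint Mk (k : nat) : 'M[int]_(m ^ k, n ^ k) :=
  match k with
  | 0 => 0
  | k'.+1 => castmx (esym (expnSr m k'), esym (expnSr n k'))
                    (morphism_phi (Mk k'))
  end.

Arguments Mk k : clear implicits.

Definition Gok (k : nat) : rel 'I_(n ^ k + m ^ k) := Go (Mk k).

Arguments Gok k : clear implicits.

(* [None] stands for infinity. *)
Definition IST : option nat :=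
  match pselect (exists l, `[< ~ semi_transitive (Gok l) >]) with
  | left ex => Some (ex_minn ex)
  | right _ => None
  end.

End Morphism.

Arguments Gok [m n] A B C k : rename.

(* A property of the triple, although C does not occur in its body. *)
Definition independent_from_C m n (A B C : 'M[int]_(m, n)) : Prop :=
  forall p j, A p j != -1 /\ B p j != -1.

Definition layered m n (M : 'M[int]_(m, n)) : Prop :=
  forall p j j', M p j = M p j'.

(* Main.v *)
(* Rows of a 0/1 matrix M are sinks of Go M and columns form a transitive
   tournament, so Go M is semi-transitive iff the ones of each row of M are
   contiguous. If A has a row r containing both 0 and 1, substituting it for two
   zeros of a same row creates the pattern 1 0 1; hence every row of A and of
   phi(A) has at most one zero, and contiguity puts the zero of a row of A at
   one of its ends. Rows (r, p) and (p, p) of phi(A) then exclude zeros in row p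
   of B, and row (P, Q) of phi(A) reads A_Q 1 .. 1 if the zero of A_P comes
   first, so the zero of A_Q cannot come last. Conversely, each of the three
   shapes is inherited by all the matrices M^k. *)
Require Import Defs.
From mathcomp Require Import all_boot all_order all_algebra.
From mathcomp Require Import boolp mxtens zify.
Set Implicit Arguments.
Unset Strict Implicit.
Unset Printing Implicit Defensive.
Import GRing.Theory.
Local Open Scope ring_scope.

(** * Semi-transitivity as contiguity of the ones in each row *)

Definition binary m n (M : 'M[int]_(m, n)) : Prop :=
  forall p j, M p j \in [:: 0; 1].

Definition row_convex m n (M : 'M[int]_(m, n)) : Prop :=
  forall p (j1 j2 j3 : 'I_n), (j1 <= j2 <= j3)%N ->
    M p j1 = 1 -> M p j3 = 1 -> M p j2 = 1.

Lemma binaryP m n (M : 'M[int]_(m, n)) p j :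
  binary M -> M p j = 0 \/ M p j = 1.
Proof. by move/(_ p j); rewrite !inE => /orP[/eqP|/eqP]; [left|right]. Qed.

Section GoBinary.
Variables (m n : nat) (M : 'M[int]_(m, n)).
Hypothesis binM : binary M.

Lemma Go_ll i j : Go M (lshift m i) (lshift m j) = (i < j)%N.
Proof. by rewrite /Go !(unsplitK (inl _)). Qed.

Lemma Go_lr j p : Go M (lshift m j) (rshift n p) = (M p j == 1).
Proof. by rewrite /Go (unsplitK (inl _)) (unsplitK (inr _)). Qed.

Lemma Go_rshift p v : Go M (rshift n p) v = false.
Proof.
rewrite /Go (unsplitK (inr _)); case: split => // j.
by case: (binaryP p j binM) => ->.
Qed.

Lemma Go_ltn u v : Go M u v -> (u < v)%N.
Proof.
case: (split_ordP u) => [i ->|p ->]; last by rewrite Go_rshift.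
case: (split_ordP v) => [j ->|q ->]; first by rewrite Go_ll.
by move=> _ /=; have := ltn_ord i; lia.
Qed.

(** Every edge increases the vertex number, so a cycle would give [x < x]. *)
Lemma Go_acyclic : acyclic (Go M).
Proof.
case=> //= x s /(sub_path Go_ltn) xs.
have tr : transitive (fun u v : 'I_(n + m) => (u < v)%N).
  by move=> ? ? ?; apply: ltn_trans.
have /allP/(_ x) := order_path_min tr xs.
by rewrite mem_rcons mem_head ltnn => /(_ isT).
Qed.

(** Rows are sinks, so all vertices of a path but the last are columns, in increasing order. If the
    last one is a row joined to the first column, contiguity joins it to every column in between. *)
Lemma row_convex_semi_transitive : row_convex M -> semi_transitive (Go M).
Proof.
move=> cvxM; split=> [|x s]; first exact: Go_acyclic.
case/lastP: s => // s y _; rewrite rcons_path last_rcons => /andP[xs sy].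
have ltxs : pairwise (fun u v : 'I_(n + m) => (u < v)%N) (x :: s).
  rewrite -path_pairwise; first exact: (sub_path Go_ltn).
  by move=> ? ? ?; apply: ltn_trans.
case: (split_ordP (last x s)) (sy) => [l El|p ->]; last by rewrite Go_rshift.
have lel z : z \in x :: s -> (x <= z <= l)%N.
  have lst : val l = last x s by rewrite El.
  rewrite lst => zs; apply/andP; split.
    move: zs; rewrite inE => /predU1P[->//|zs]; apply: ltnW.
    by move: ltxs => /= /andP[/allP/(_ z zs)].
  move: zs ltxs; rewrite lastI mem_rcons inE => /predU1P[->//|zs].
  by rewrite pairwise_rcons => /andP[/allP/(_ z zs)/ltnW].
(* Rows are numbered after all columns, so a vertex bounded by [l] is a column. *)
have colP z : z \in x :: s -> exists2 j, z = lshift m j & (x <= j <= l)%N.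
  move=> /lel; case: (split_ordP z) => [j ->|p ->] /=; first by exists j.
  by have := ltn_ord l; lia.
have cols : pairwise (Go M) (x :: s).
  apply: (sub_in_pairwise (P := mem (x :: s)) _ _ ltxs); last exact/allP.
  move=> u v /colP[i -> _] /colP[j -> _] /=.
  by rewrite Go_ll.
move=> ly; case: (boolP (Go M x y)) => xy; [right|by left].
rewrite -rcons_cons pairwise_rcons cols andbT; apply/allP => z zs.
move: (lel z zs); case/colP: (zs) => j -> _ /=.
case/colP: (mem_head x s) xy => i -> _ iy /= jl.
move: ly iy; rewrite El; case: (split_ordP y) => [k ->|p ->].
  by rewrite !Go_ll; lia.
rewrite !Go_lr => /eqP lp /eqP ip; apply/eqP; exact: cvxM jl ip lp.
Qed.

(** The path [j1 -> j2 -> j3 -> p] has the shortcut [j1 -> p], which forces the edge [j2 -> p]. *)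
Lemma semi_transitive_row_convex : semi_transitive (Go M) -> row_convex M.
Proof.
move=> [_ st] p j1 j2 j3 /andP[].
rewrite leq_eqVlt => /predU1P[/val_inj->//|lt12].
rewrite leq_eqVlt => /predU1P[/val_inj->//|lt23] M1 M3.
have := st (lshift m j1) [:: lshift m j2; lshift m j3; rshift n p] isT.
rewrite /= !Go_ll !Go_lr M1 M3 lt12 lt23 eqxx => /(_ isT) [//|].
by case/and3P => _ /and3P[_ /eqP].
Qed.

Lemma Go_semi_transitive : semi_transitive (Go M) <-> row_convex M.
Proof.
by split; [exact: semi_transitive_row_convex|exact: row_convex_semi_transitive].
Qed.

End GoBinary.

(** * Contiguity in block coordinates, and the case of layered [A] *)

Lemma castmx_row_convex m n m' n' (e : (m = m') * (n = n')) M :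
  row_convex (castmx e M) <-> row_convex M.
Proof.
by case: e M => em en; case: m' / em; case: n' / en => M; rewrite castmx_id.
Qed.

Section Phi.
Variables (m n : nat) (A B C : 'M[int]_(m, n)).
Hypotheses (binA : binary A) (binB : binary B).

Local Notation phi := (morphism_phi A B C).

Lemma phi_castmx m1 n1 m2 n2 (e : (m1 = m2) * (n1 = n2)) M :
  phi (castmx e M) =
  castmx (congr1 (muln^~ m) e.1, congr1 (muln^~ n) e.2) (phi M).
Proof.
by case: e M => em en; case: m2 / em; case: n2 / en => M; rewrite !castmx_id.
Qed.

Lemma phiE m' n' (M : 'M[int]_(m', n')) P p J j :
  phi M (mxtens_index (P, p)) (mxtens_index (J, j)) = block A B C (M P J) p j.
Proof. by rewrite mxE !mxtens_indexK. Qed.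

Lemma phi_binary m' n' (M : 'M[int]_(m', n')) : binary M -> binary (phi M).
Proof.
move=> binM i j; rewrite mxE /block.
by case: (binaryP (mxtens_unindex i).1 (mxtens_unindex j).1 binM) => -> /=;
  [exact: binA|exact: binB].
Qed.

Lemma Mk_binary k : binary (Mk A B C k).
Proof.
elim: k => [|k IHk] p j /=; first by rewrite mxE.
by rewrite castmxE; apply: phi_binary.
Qed.

Lemma IST_None : IST A B C = None <-> forall k, row_convex (Mk A B C k).
Proof.
rewrite /IST; case: pselect => [ex|nex]; split=> //.
  by move=> cvx; case: (ex) => k /asboolP[];
    apply: (Go_semi_transitive (@Mk_binary k)).2; exact: cvx.
move=> _ k; apply: (Go_semi_transitive (@Mk_binary k)).1.
by apply: contrapT => nst; apply: nex; exists k; apply/asboolP.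
Qed.

Lemma phi_row_convex m' n' (M : 'M[int]_(m', n')) P p
    (J1 J2 J3 : 'I_n') (j1 j2 j3 : 'I_n) :
  row_convex (phi M) ->
  (J1 * n + j1 <= J2 * n + j2 <= J3 * n + j3)%N ->
  block A B C (M P J1) p j1 = 1 -> block A B C (M P J3) p j3 = 1 ->
  block A B C (M P J2) p j2 = 1.
Proof. by move=> cvx le; rewrite -!phiE; apply: cvx. Qed.

(* A block repeated in a row of blocks has only constant rows: [.. 1 .. 0 ..]
   twice contains 1, 0, 1 in this order, and so does [.. 0 .. 1 ..] twice. *)
Lemma phi_repeat m' n' (M : 'M[int]_(m', n')) P p (J1 J2 : 'I_n') :
  row_convex (phi M) -> M P J1 = M P J2 -> J1 != J2 ->
  forall x y, block A B C (M P J1) p x = 1 -> block A B C (M P J1) p y = 1.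
Proof.
move=> cvx; wlog lt12 : J1 J2 / (J1 < J2)%N => [W E ne x y|E _ x y Bx].
  move: (ne); rewrite neq_ltn => /orP[lt|lt]; first exact: W lt E ne x y.
  by rewrite E; apply: W lt (esym E) _ x y; rewrite eq_sym.
have le12 : (J1 * n + n <= J2 * n)%N.
  by rewrite addnC -mulSn leq_mul2r lt12 orbT.
have ltx := ltn_ord x; have lty := ltn_ord y.
have [lexy|ltyx] := leqP x y.
  by apply: (@phi_row_convex _ _ M P p J1 J1 J2 x y x); rewrite -?E //; lia.
rewrite E.
by apply: (@phi_row_convex _ _ M P p J1 J2 J2 x y x); rewrite -?E //; lia.
Qed.

(** Row [P] of [A] consists of ones, so [phi A] has a row of blocks all equal to [B]. *)
Lemma layered_necessary :
  layered A -> (exists p j, A p j = 1) -> row_convex (phi A) -> layered B.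
Proof.
move=> layA [P [J AJ]] cvx.
suff B1 p x y : B p x = 1 -> B p y = 1.
  move=> p x y; case: (binaryP p x binB) (B1 p y x) (B1 p x y) => ->.
    by case: (binaryP p y binB) => -> // /(_ erefl).
  by move=> _ ->.
case: (eqVneq x y) => [->//|nexy].
(* The columns [x] and [y] also serve as the two distinct block positions. *)
have := @phi_repeat _ _ A P p x y cvx (layA _ _ _) nexy x y.
by rewrite (layA P x J) AJ.
Qed.

(** * Necessary conditions when some row of [A] is not constant *)

Section NotLayered.
Variables (r : 'I_m) (x1 x0 : 'I_n).
Hypotheses (Arx1 : A r x1 = 1) (Arx0 : A r x0 = 0).

Lemma phi_unique_zero m' n' (M : 'M[int]_(m', n')) P J1 J2 :
  row_convex (phi M) -> M P J1 = 0 -> M P J2 = 0 -> J1 = J2.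
Proof.
move=> cvx M1 M2; apply: contra_eq (Arx0) => ne.
have := @phi_repeat _ _ M P r _ _ cvx (etrans M1 (esym M2)) ne x1 x0.
by rewrite M1 => ->.
Qed.

Hypotheses (cvx1 : row_convex A) (cvx2 : row_convex (phi A)).
Hypothesis cvx3 : row_convex (phi (phi A)).

Let x10 : x1 != x0.
Proof. by apply: contra_eq_neq Arx1 => ->; rewrite Arx0. Qed.

Let A_unique_zero P J1 J2 : A P J1 = 0 -> A P J2 = 0 -> J1 = J2.
Proof. exact: phi_unique_zero. Qed.

Let phi_unique_zero_block P p J1 J2 j1 j2 :
  block A B C (A P J1) p j1 = 0 -> block A B C (A P J2) p j2 = 0 -> J1 = J2.
Proof.
rewrite -!phiE => z1 z2; have := phi_unique_zero cvx3 z1 z2.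
by move/(can_inj (@mxtens_indexK _ _)) => [].
Qed.

Lemma nonlayered_necessary_B : B = const_mx 1.
Proof.
apply/matrixP => p y; rewrite mxE; case: (binaryP p y binB) => // By.
case: (pselect (exists z, A p z = 0)) => [[z Az]|nz].
  (* Row [(r, p)] of [phi A] has a zero in block [x1], a copy of [B], and another in block [x0], a
     copy of [A]. *)
  case/eqP: x10; apply: (@phi_unique_zero_block r p _ _ y z).
    by rewrite Arx1.
  by rewrite Arx0.
have A1 z : A p z = 1.
  by case: (binaryP p z binA) => // Az; case: nz; exists z.
(* Here row [p] of [A] consists of ones, so blocks [x1] and [x0] of row [(p, p)] are both copies of
   [B], each with a zero at [y]. *)
by case/eqP: x10; apply: (@phi_unique_zero_block p p _ _ y y); rewrite A1.
Qed.

Lemma zero_at_an_end P z : A P z = 0 -> z = 0%N :> nat \/ z.+1 = n.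
Proof.
move=> Az; have n0 : (0 < n)%N by have := ltn_ord z; lia.
have n1 : (n.-1 < n)%N by lia.
case: (pselect (z = 0%N :> nat)) => z0; first by left.
case: (pselect (z.+1 = n)) => z1; [by right|exfalso].
have A1 (j : 'I_n) : j <> z :> nat -> A P j = 1.
  move=> ne; case: (binaryP P j binA) => // Aj.
  by case: ne; rewrite (A_unique_zero Aj Az).
have : A P z = 1.
  apply: (@cvx1 P (Ordinal n0) z (Ordinal n1)).
  - by rewrite /=; have := ltn_ord z; lia.
  - by apply: A1 => /= /esym.
  - by apply: A1 => /=; lia.
by rewrite Az.
Qed.

Lemma zeros_not_at_both_ends P Q u v :
  A P u = 0 -> A Q v = 0 -> u = 0%N :> nat -> v.+1 = n -> False.
Proof.
move=> Au Av u0 v1.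
(* Equality would give [n = 1], leaving no room for [x1 != x0]. *)
have uv : u != v.
  apply: contraNneq x10 => uv; apply/eqP/val_inj => /=.
  by have := ltn_ord x1; have := ltn_ord x0; rewrite uv in u0; lia.
have AQu : A Q u = 1.
  by case: (binaryP Q u binA) => // Aj; case/eqP: uv;
    apply: A_unique_zero Aj Av.
have APv : A P v = 1.
  by case: (binaryP P v binA) => // Aj; case/eqP: uv;
    apply: A_unique_zero Au Aj.
suff : block A B C (A P u) Q v = 1 by rewrite Au Av.
(* In row [(P, Q)], block [u] is [A] and block [v] is [B]: the ones at [(u, u)] and [(v, u)] enclose
   the zero at [(u, v)]. *)
apply: (@phi_row_convex _ _ A P Q u u v u v u cvx2); first by rewrite u0; nia.
  by rewrite Au.
by rewrite APv nonlayered_necessary_B /block /= mxE.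
Qed.

(** The zero of row [r] selects the end; no other row can have its zero at the opposite end. *)
Lemma nonlayered_necessary_A :
  (forall p (j : 'I_n), (0 < j)%N -> A p j = 1) \/
  (forall p (j : 'I_n), (j.+1 < n)%N -> A p j = 1).
Proof.
have E := zero_at_an_end; have F := zeros_not_at_both_ends.
case: (E r x0 Arx0) => e; [left|right] => p j lj;
  case: (binaryP p j binA) => // Aj; case: (E p j Aj) => ej; try lia.
  by case: (F r p x0 j).
by case: (F p r j x0).
Qed.

End NotLayered.

(** Up to casts of the dimensions, the three matrices are the iterates of index 1, 2 and 3. *)
Lemma Mk_row_convex_phi :
  (forall k, row_convex (Mk A B C k)) ->
  [/\ row_convex A, row_convex (phi A) & row_convex (phi (phi A))].
Proof.
have Mk1 : Mk A B C 1 = castmx (esym (expn1 m), esym (expn1 n)) A.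
  apply/matrixP => i j; rewrite /= !castmxE mxE !mxE /block /=.
  congr (A _ _); apply: val_inj => /=;
    by rewrite modn_small // -[X in (_ < X)%N]expn1.
move=> cvx; split.
- by have := cvx 1%N; rewrite Mk1 => /castmx_row_convex.
- have := cvx 2%N; rewrite -[Mk _ _ _ 2]/(castmx _ (phi (Mk A B C 1))) Mk1.
  by rewrite phi_castmx => /castmx_row_convex/castmx_row_convex.
have := cvx 3%N.
rewrite -[Mk _ _ _ 3]/(castmx _ (phi (castmx _ (phi (Mk A B C 1))))) Mk1.
by rewrite !phi_castmx; do 3 move/castmx_row_convex.
Qed.

(** * Inheritance of the three shapes by the iterates *)

Lemma Mk_layered k : layered A -> layered B -> layered (Mk A B C k).
Proof.
move=> layA layB; elim: k => [|k IHk] p j j' /=; first by rewrite !mxE.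
rewrite !castmxE !mxE; set P := (mxtens_unindex _).1.
set J := (mxtens_unindex _).1; set J' := (mxtens_unindex _).1.
(* Row [P] of the previous iterate is constant, so both columns fall in copies of the same block. *)
rewrite (IHk P J J') /block.
by case: (binaryP P J' (@Mk_binary k)) => ->; [exact: layA|exact: layB].
Qed.

Section Ones.
Hypothesis B1 : B = const_mx 1.

Lemma block_ones x p j : x = 1 \/ A p j = 1 /\ x = 0 -> block A B C x p j = 1.
Proof. by rewrite /block B1; case=> [->|[A1 ->]]; rewrite //= mxE. Qed.

(** By induction the block [A] can occur only in the first block column; there, a column other than
    the first of the whole matrix is not the first of its block. *)
Lemma Mk_ones_but_first k p (j : 'I_(n ^ k)) :
  (forall p (j : 'I_n), (0 < j)%N -> A p j = 1) ->
  (0 < j)%N -> Mk A B C k p j = 1.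
Proof.
move=> A1; elim: k p j => [|k IHk] p j j0 /=.
  by have := ltn_ord j; rewrite [X in (_ < X)%N]expn0; lia.
rewrite castmxE mxE; set P := (mxtens_unindex _).1; set J := mxtens_unindex _.
have Ej : j = (J.1 * n + J.2)%N :> nat by exact: divn_eq.
apply: block_ones; case: (binaryP P J.1 (@Mk_binary k)) => E; [right|by left].
split=> //; apply: A1; rewrite lt0n; apply: contraPneq E => J2.
rewrite IHk //; rewrite lt0n; apply: contraTneq j0 => J1.
by rewrite Ej J1 J2.
Qed.

(** Mirror image: the block [A] can occur only in the last block column. *)
Lemma Mk_ones_but_last k p (j : 'I_(n ^ k)) :
  (forall p (j : 'I_n), (j.+1 < n)%N -> A p j = 1) ->
  (j.+1 < n ^ k)%N -> Mk A B C k p j = 1.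
Proof.
move=> A1; elim: k p j => [|k IHk] p j jn /=.
  by move: jn; rewrite [X in (_ < X)%N]expn0; lia.
rewrite castmxE mxE; set P := (mxtens_unindex _).1; set J := mxtens_unindex _.
have Ej : j = (J.1 * n + J.2)%N :> nat by exact: divn_eq.
apply: block_ones; case: (binaryP P J.1 (@Mk_binary k)) => E; [right|by left].
split=> //; apply: A1; rewrite ltnNge; apply: contraPN E => J2.
rewrite IHk //; rewrite ltnNge; apply: contraTN jn => J1.
by rewrite Ej expnSr; nia.
Qed.

End Ones.
End Phi.

Lemma layered_row_convex m n (M : 'M[int]_(m, n)) : layered M -> row_convex M.
Proof. by move=> layM p j1 j2 j3 _ <- _; apply: layM. Qed.

Lemma ones_but_first_row_convex m n (M : 'M[int]_(m, n)) :
  (forall p (j : 'I_n), (0 < j)%N -> M p j = 1) -> row_convex M.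
Proof.
move=> M1 p j1 j2 j3 /andP[le12 _] Mj1 _.
have [j2_0|] := posnP j2; last exact: M1.
by rewrite -Mj1; congr (M p _); apply: val_inj => /=; lia.
Qed.

Lemma ones_but_last_row_convex m n (M : 'M[int]_(m, n)) :
  (forall p (j : 'I_n), (j.+1 < n)%N -> M p j = 1) -> row_convex M.
Proof.
move=> M1 p j1 j2 j3 /andP[_ le23] _ Mj3.
have [|j2n] := ltnP j2.+1 n; first exact: M1.
by rewrite -Mj3; congr (M p _); apply: val_inj => /=; have := ltn_ord j3; lia.
Qed.

Lemma sign_binary m n (M : 'M[int]_(m, n)) :
  sign_matrix M -> (forall p j, M p j != -1) -> binary M.
Proof.
by move=> sM nM p j; move: (sM p j); rewrite inE (negPf (nM p j)).
Qed.

(* The hypothesis that A has an entry 1 is not in the source. Without it the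
   equivalence is false: if A = 0 then M^k(A,B,C) = 0 for all k, so IST = oo
   for every B, layered or not (e.g. A = [0 0], B = [0 1]). As A has no entry
   -1, the hypothesis excludes exactly A = 0. *)
Theorem theorem3p12 (m n : nat) (A B C : 'M[int]_(m, n))
    (signA : sign_matrix A) (signB : sign_matrix B) (signC : sign_matrix C)
    (A_has_0 : exists p j, A p j = 0)
    (A_has_1 : exists p j, A p j = 1)
    (indepC : independent_from_C A B C) :
  IST A B C = None <->
    [\/ layered A /\ layered B,
        B = const_mx 1 /\
        (forall (p : 'I_m) (j : 'I_n), (0 < j)%N -> A p j = 1) /\
        (forall (p : 'I_m) (j : 'I_n), j = 0%N :> nat -> A p j \in [:: 0; 1])
      | B = const_mx 1 /\
        (forall (p : 'I_m) (j : 'I_n), (j.+1 < n)%N -> A p j = 1) /\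
        (forall (p : 'I_m) (j : 'I_n), j.+1 = n -> A p j \in [:: 0; 1])].
Proof.
have binA : binary A by apply: sign_binary => // p j; case: (indepC p j).
have binB : binary B by apply: sign_binary => // p j; case: (indepC p j).
split=> [/(IST_None C binA binB) cvx|cases]; last first.
  apply/(IST_None C binA binB) => k.
  case: cases => [[]|[B1 [A1 _]]|[B1 [A1 _]]].
  - by move=> layA layB; apply/layered_row_convex/Mk_layered.
  - by apply: ones_but_first_row_convex => p j; apply: Mk_ones_but_first.
  - by apply: ones_but_last_row_convex => p j; apply: Mk_ones_but_last.
have [cvx1 cvx2 cvx3] := Mk_row_convex_phi cvx.
case: (pselect (layered A)) => [layA|nlayA].
  by constructor 1; split=> //; apply: layered_necessary cvx2.
have [r [x1 [x0 [A1 A0]]]] : exists r x1 x0, A r x1 = 1 /\ A r x0 = 0.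
  apply: contrapT => nx; apply: nlayA => p j j'.
  have := (binaryP p j binA, binaryP p j' binA).
  case=> [[E|E] [E'|E']]; rewrite E E' //; exfalso; apply: nx.
    by exists p, j', j.
  by exists p, j, j'.
have B1 := nonlayered_necessary_B binA binB A1 A0 cvx3.
by case: (nonlayered_necessary_A binA binB A1 A0 cvx1 cvx2 cvx3);
  [constructor 2|constructor 3]; do 2 split=> //.
Qed.
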